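(* Let $\mathcal{N}$ be a model of the base theory $F$ ($=\mathrm{RCA}_0^*$) that realizes $\mathrm{SRT}^2_{<\infty}$. Then the problem $\mathrm{FICF}$ is Weihrauch reducible over $\mathcal{N}$ to $\mathrm{SRT}^2_{<\infty}$.
   Context: Setting: $\mathcal{N}=(N,\mathcal{P},+,\times,<,0,1)$ with $\mathcal{P}\subseteq 2^N$ is a (possibly nonstandard) second-order model of arithmetic; elements of $N$ are called integers and elements of $\mathcal{P}$ are called sets. $\mathcal{N}$ satisfies the base theory $F$, consisting of $P^-$ (Peano arithmetic without induction), $\mathrm{I}\Delta^0_0$, the totality of exponentiation, and $\Delta^0_1$-comprehension; $F$ is also called $\mathrm{RCA}_0^*$. A set is finite iff it is bounded by some integer of $N$, and infinite otherwise. The c.e. sets are the $\Sigma^0_1$-definable subsets of $N$ (parameters allowed; they need not lie in $\mathcal{P}$); $W_e$ is the $e$th c.e. set, with stage-$s$ approximation $W_{e,s}$. $W_e$ is cofinite iff $\exists k\,\forall x>k\,\exists s\,(x\in W_{e,s})$. A problem is an arithmetical formula $\mathcal{A}(I,S)$, with no parameters other than $I,S$, asserting that $S$ is a solution of the instance $I$. $\mathcal{N}$ realizes $\mathcal{A}$ iff in $\mathcal{N}$ for all $I$ there is $S$ with $\mathcal{A}(I,S)$ (an $I$ that is not an instance is by convention given the solution $\emptyset$, so only genuine instances matter). Weihrauch reducibility over $\mathcal{N}$: $\mathcal{A}_0\le_W\mathcal{A}_1$ iff $\mathcal{N}$ realizes $\mathcal{A}_1$ and there are Turing functionals ($\Delta^0_1$-definable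 partial functions, total on all reasonable oracles from $\mathcal{P}$, i.e. instances $I_0$ of $\mathcal{A}_0$ and solutions $S_1$) $\Phi$ and $\Psi$ such that $\mathcal{N}$ satisfies $\forall I_0\forall S_1\,(\mathcal{A}_1(\Phi(I_0),S_1)\Rightarrow\mathcal{A}_0(I_0,\Psi(I_0,S_1)))$. $\mathrm{FICF}$: an instance is a finite collection of c.e. sets $\{W_{f(e)}\mid e<n\}$ ($n\in N$, $f$ computable) whose intersection $\bigcap_{e<n}W_{f(e)}$ is not cofinite; a solution is an $e<n$ such that $W_{f(e)}$ is not cofinite. $\mathrm{SRT}^2_{<\infty}$: an instance is a $k$-coloring $C$, for some $k\in N$, of $[X]^2$ (the two-element subsets of $X$), for some infinite set $X\subseteq N$, that is stable, i.e. $\lim_s C(x,s)$ exists for every $x\in X$; a solution is an infinite set $H\subseteq X$ that is homogeneous, i.e. $C$ is constant on $[H]^2$. *)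

(* Defs.v *)
(* MathComp world; sets are those of mathcomp.classical. *)
From Stdlib Require List.
From mathcomp Require Import all_boot.
From mathcomp Require Import classical_sets.
Set Implicit Arguments.
Unset Strict Implicit.
Unset Printing Implicit Defensive.
Local Open Scope classical_set_scope.

Record structure := Structure {
  carrier :> Type;
  zero : carrier;
  one : carrier;
  add : carrier -> carrier -> carrier;
  mul : carrier -> carrier -> carrier;
  lt : carrier -> carrier -> Prop;
  sets : set (set carrier)
}.
Arguments zero {_}.
Arguments one {_}.
Arguments add {_} _ _.
Arguments mul {_} _ _.
Arguments lt {_} _ _.
Arguments sets : clear implicits.

Definition le {M : structure} (x y : M) : Prop := lt x y \/ x = y.

Declare Scope arith_scope.
Delimit Scope arith_scope with A.
Notation "0" := zero : arith_scope.
Notation "1" := one : arith_scope.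
Notation "x + y" := (add x y) : arith_scope.
Notation "x * y" := (mul x y) : arith_scope.
Notation "x < y" := (lt x y) : arith_scope.
Notation "x <= y" := (le x y) : arith_scope.
Local Open Scope arith_scope.

(* Delta^0_0 formulas, with de Bruijn indices for number variables; the bound
   of a bounded quantifier is evaluated outside the scope of the quantifier. *)
Inductive term :=
  | TVar of nat
  | TZero
  | TOne
  | TAdd of term & term
  | TMul of term & term.

Inductive formula :=
  | FEq of term & term
  | FLt of term & term
  | FMem of term & nat
  | FNot of formula
  | FAnd of formula & formula
  | FOr of formula & formula
  | FAll of term & formula
  | FEx of term & formula.

Fixpoint eval {M : structure} (rho : seq M) (t : term) : M :=
  match t with
  | TVar i => nth zero rho i
  | TZero => 0
  | TOne => 1
  | TAdd t u => eval rho t + eval rho u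
  | TMul t u => eval rho t * eval rho u
  end.

(* [Xi] lists the set parameters and [rho] the number parameters. Variables
   beyond the end of these lists denote the empty set and 0 respectively. *)
Fixpoint sat {M : structure} (Xi : seq (set M)) (rho : seq M) (phi : formula)
    : Prop :=
  match phi with
  | FEq t u => eval rho t = eval rho u
  | FLt t u => eval rho t < eval rho u
  | FMem t i => nth set0 Xi i (eval rho t)
  | FNot p => ~ sat Xi rho p
  | FAnd p q => sat Xi rho p /\ sat Xi rho q
  | FOr p q => sat Xi rho p \/ sat Xi rho q
  | FAll t p => forall x, x < eval rho t -> sat Xi (x :: rho) p
  | FEx t p => exists x, x < eval rho t /\ sat Xi (x :: rho) p
  end.

Definition sigma01 {M : structure} (Xi : seq (set M)) (rho : seq M)
  (phi : formula) : Prop := exists y, sat Xi (y :: rho) phi.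
Definition pi01 {M : structure} (Xi : seq (set M)) (rho : seq M)
  (phi : formula) : Prop := forall y, sat Xi (y :: rho) phi.

Record PA_minus (M : structure) : Prop := {
  PA_addA : forall x y z : M, (x + y) + z = x + (y + z);
  PA_addC : forall x y : M, x + y = y + x;
  PA_mulA : forall x y z : M, (x * y) * z = x * (y * z);
  PA_mulC : forall x y : M, x * y = y * x;
  PA_mulD : forall x y z : M, x * (y + z) = x * y + x * z;
  PA_add0 : forall x : M, x + 0 = x;
  PA_mul0 : forall x : M, x * 0 = 0;
  PA_mul1 : forall x : M, x * 1 = x;
  PA_lt_trans : forall x y z : M, x < y -> y < z -> x < z;
  PA_lt_irrefl : forall x : M, ~ x < x;
  PA_lt_total : forall x y : M, x < y \/ x = y \/ y < x;
  PA_lt_add : forall x y z : M, x < y -> x + z < y + z;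
  PA_lt_mul : forall x y z : M, 0 < z -> x < y -> x * z < y * z;
  PA_lt_sub : forall x y : M, x < y -> exists z, x + z = y;
  PA_lt01 : (0 : M) < 1;
  PA_discrete : forall x : M, 0 < x -> 1 <= x;
  PA_le0 : forall x : M, 0 <= x
}.

(* An injective pairing, with x, y <= mpair x y: since
   (x+y)^2 <= mpair x y < (x+y+1)^2, the sum x+y, hence also x, is determined. *)
Definition mpair {M : structure} (x y : M) : M := (x + y) * (x + y) + x.

(* Goedel's beta function: the [i]th entry of the sequence coded by
   [mpair a b] is the remainder of [a] by [1 + (i+1)b]. *)
Definition entry {M : structure} (c i r : M) : Prop :=
  exists a b, c = mpair a b /\
    r < 1 + (i + 1) * b /\ exists q, a = q * (1 + (i + 1) * b) + r.

Definition is_exp {M : structure} (x y z : M) : Prop :=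
  exists c, entry c 0 1 /\
    (forall i, i < y -> exists u, entry c i u /\ entry c (i + 1) (u * x)) /\
    entry c y z.

Record RCA0star (M : structure) : Prop := {
  PA_minus_of : PA_minus M;
  delta00_induction : forall (phi : formula) (Xi : seq (set M)) (rho : seq M),
    List.Forall (sets M) Xi ->
    sat Xi (0 :: rho) phi ->
    (forall x, sat Xi (x :: rho) phi -> sat Xi (x + 1 :: rho) phi) ->
    forall x, sat Xi (x :: rho) phi;
  exp_total : forall x y : M, exists z, is_exp x y z;
  delta01_comprehension :
    forall (phi psi : formula) (Xi : seq (set M)) (rho : seq M),
    List.Forall (sets M) Xi ->
    (forall x, sigma01 Xi (x :: rho) phi <-> pi01 Xi (x :: rho) psi) ->
    sets M [set x | sigma01 Xi (x :: rho) phi]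
}.

Definition finite {M : structure} (A : set M) : Prop :=
  exists b, forall x, A x -> x <= b.
Definition infinite {M : structure} (A : set M) : Prop := ~ finite A.

(* The c.e. sets are enumerated by Minsky register machines. The index
   [mpair L p] is the program of length [L] whose [j]th instruction is the [j]th
   entry of [p], where
   - [mpair 0 (mpair r k)] increments register [r] and goes to [k];
   - [mpair 1 (mpair r (mpair k l))] decrements register [r] and goes to [k] if
     that register is positive, and goes to [l] otherwise;
   - any other code has no successor state.
   The machine halts on reaching an instruction number at least [L]. *)

(* Instruction [w] goes to [q], changing register [r] from [u] to [v]. *)
Definition instr {M : structure} (w q r u v : M) : Prop :=
  (w = mpair 0 (mpair r q) /\ v = u + 1) \/
  exists k l, w = mpair 1 (mpair r (mpair k l)) /\
    ((u = v + 1 /\ q = k) \/ (u = 0 /\ v = 0 /\ q = l)).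

(* A history [h] has the instruction number at time [t] as entry [mpair t 0],
   and the content of register [i] at time [t] as entry [mpair t (i + 1)]. Only
   the registers [i <= e] are recorded: every register mentioned by the
   program [e] is among them, as a pair bounds its components and a code
   of a sequence bounds its entries. *)
Definition initial {M : structure} (e x h : M) : Prop :=
  entry h (mpair 0 0) 0 /\ entry h (mpair 0 1) x /\
  forall i, 0 < i -> i <= e -> entry h (mpair 0 (i + 1)) 0.

Definition step {M : structure} (e L p h t : M) : Prop :=
  exists j w q r u v, j < L /\ entry p j w /\ instr w q r u v /\
    entry h (mpair t 0) j /\ entry h (mpair (t + 1) 0) q /\
    entry h (mpair t (r + 1)) u /\ entry h (mpair (t + 1) (r + 1)) v /\
    forall i, i <= e -> i <> r ->
      exists z, entry h (mpair t (i + 1)) z /\ entry h (mpair (t + 1) (i + 1)) z.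

Definition accepts {M : structure} (e x h T : M) : Prop :=
  exists L p, e = mpair L p /\ initial e x h /\
    (forall t, t < T -> step e L p h t) /\
    exists j, entry h (mpair T 0) j /\ L <= j.

Definition W_stage {M : structure} (e s : M) : set M :=
  [set x | exists h T, h <= s /\ T <= s /\ accepts e x h T].

Definition W {M : structure} (e : M) : set M := [set x | exists s, W_stage e s x].

Definition computable {M : structure} (A : set M) : Prop :=
  (exists i, A = W i) /\ (exists j, ~` A = W j).

Definition cofinite {M : structure} (A : set M) : Prop :=
  exists k, forall x, k < x -> A x.

(* The predicates apply to arbitrary subsets of the structure; only those in
   [sets M] are considered in [realizes] and [weihrauch]. *)
Record problem := Problem {
  instance_of : forall M : structure, set M -> Prop;
  solution_of : forall M : structure, set M -> set M -> Prop
}.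

Definition realizes (M : structure) (A : problem) : Prop :=
  forall I, sets M I -> instance_of A I ->
    exists S, sets M S /\ solution_of A I S.

(* A Turing functional is given by Sigma^0_1 formulas, with number parameters
   but no set parameters besides the oracles, for membership and
   non-membership in its value. *)
Record functional (M : structure) := Functional {
  pos : formula;
  neg : formula;
  params : seq M
}.

Definition total_on {M : structure} (Phi : functional M) (Xi : seq (set M)) :=
  forall x, sigma01 Xi (x :: params Phi) (pos Phi) <->
            ~ sigma01 Xi (x :: params Phi) (neg Phi).

Definition value {M : structure} (Phi : functional M) (Xi : seq (set M))
    : set M :=
  [set x | sigma01 Xi (x :: params Phi) (pos Phi)].

Definition weihrauch (M : structure) (A0 A1 : problem) : Prop :=
  realizes M A1 /\
  exists Phi Psi : functional M,
    forall I0, sets M I0 -> instance_of A0 I0 ->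
      let I1 := value Phi [:: I0] in
      total_on Phi [:: I0] /\ instance_of A1 I1 /\
      forall S1, sets M S1 -> solution_of A1 I1 S1 ->
        total_on Psi [:: I0; S1] /\ solution_of A0 I0 (value Psi [:: I0; S1]).

(* The two halves of a join. *)
Definition left_half {M : structure} (I : set M) : set M :=
  [set x | I ((1 + 1) * x)].
Definition right_half {M : structure} (I : set M) : set M :=
  [set x | I ((1 + 1) * x + 1)].

(* An instance of FICF is the join of {n} and of the graph of f; a solution e
   is presented as the set {e}. *)
Definition FICF_fun {M : structure} (I : set M) (e y : M) : Prop :=
  right_half I (mpair e y).

Definition FICF_instance (M : structure) (I : set M) : Prop :=
  exists n, left_half I = [set n] /\
    (forall e, exists! y, FICF_fun I e y) /\
    computable [set z | exists e y, z = mpair e y /\ FICF_fun I e y] /\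
    ~ cofinite [set x | forall e y, e < n -> FICF_fun I e y -> W y x].

Definition FICF_solution (M : structure) (I S : set M) : Prop :=
  exists n e y, left_half I = [set n] /\ e < n /\ FICF_fun I e y /\
    ~ cofinite (W y) /\ S = [set e].

Definition FICF : problem := Problem FICF_instance FICF_solution.

(* An instance of SRT^2_{<oo} is the join of X and of a set of triples whose
   triples (x, y, c) with x < y in X form the graph of the coloring C; the
   unordered pair {x, y} is represented by its increasing enumeration. *)
Definition SRT2_color {M : structure} (I : set M) (x y c : M) : Prop :=
  right_half I (mpair (mpair x y) c).

Definition coloring {M : structure} (I : set M) (k : M) : Prop :=
  forall x y, left_half I x -> left_half I y -> x < y ->
    (exists! c, SRT2_color I x y c) /\
    (forall c, SRT2_color I x y c -> c < k).

Definition stable {M : structure} (I : set M) : Prop :=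
  forall x, left_half I x ->
    exists c t, forall s, left_half I s -> x < s -> t < s -> SRT2_color I x s c.

Definition SRT2_instance (M : structure) (I : set M) : Prop :=
  infinite (left_half I) /\ (exists k, coloring I k) /\ stable I.

Definition SRT2_solution (M : structure) (I S : set M) : Prop :=
  infinite S /\ S `<=` left_half I /\
  exists c, forall x y, S x -> S y -> x < y -> SRT2_color I x y c.

Definition SRT2 : problem := Problem SRT2_instance SRT2_solution.

(* Main.v *)
From Stdlib Require Import Ring.
From mathcomp Require Import all_boot.
From mathcomp Require Import boolp classical_sets.
Require Import Defs.
Set Implicit Arguments.
Unset Strict Implicit.
Unset Printing Implicit Defensive.
Local Open Scope classical_set_scope.
Local Open Scope arith_scope.

(* Write A_e for W_{f(e)} and A_{e,s} for its approximation at stage s. The pair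
   x < s gets as color the least e < n such that y is not in A_{e,s}, where y is
   the least element from x on that is missing from some A_{e,s}. As s grows, y
   moves up to the least element from x on that is missing from the
   intersection, and e to the least index missing that y; so the coloring is
   stable, and if c is the color of a homogeneous set then A_c misses elements
   above every x in that set. Both limits need Sigma^0_1 induction, which is not
   in RCA_0^* but follows from SRT^2_{<oo}, because its instances may live on an
   infinite set of stages indexed by a proper cut. *)

Section Arithmetic.
Context (M : structure) (hP : PA_minus M).
Implicit Types x y z u v : M.

Lemma semi_ring_of : semi_ring_theory (0 : M) 1 add mul eq.
Proof.
have [addA addC mulA mulC mulD add0 mul0 mul1 _ _ _ _ _ _ _ _ _] := hP.
split=> //.
- by move=> x; rewrite addC.
- by move=> x; rewrite mulC.
- by move=> x; rewrite mulC.
- by move=> x y z; rewrite mulC mulD !(mulC z).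
Qed.

Add Ring Mring : semi_ring_of.

Lemma le_refl x : x <= x. Proof. by right. Qed.

Lemma lt_trans x y z : x < y -> y < z -> x < z.
Proof. exact: (PA_lt_trans hP). Qed.

Lemma lt_irrefl x : ~ x < x.
Proof. exact: (PA_lt_irrefl hP). Qed.

Lemma lt_le_trans x y z : x < y -> y <= z -> x < z.
Proof. by move=> xy [yz|<-] //; apply: lt_trans yz. Qed.

Lemma le_lt_trans x y z : x <= y -> y < z -> x < z.
Proof. by move=> [xy|->] // yz; apply: lt_trans yz. Qed.

Lemma le_trans x y z : x <= y -> y <= z -> x <= z.
Proof. by move=> [xy|->] // yz; left; apply: lt_le_trans yz. Qed.

Lemma le_or_lt x y : x <= y \/ y < x.
Proof.
by case: (PA_lt_total hP x y) => [|[->|]]; [left; left|left; right|right].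
Qed.

Lemma lt_not_le x y : x < y -> ~ y <= x.
Proof. by move=> xy yx; apply: (@lt_irrefl x); apply: lt_le_trans yx. Qed.

Lemma not_lt_le x y : ~ x < y -> y <= x.
Proof. by case: (le_or_lt y x). Qed.

Lemma le0 x : 0 <= x. Proof. exact: (PA_le0 hP). Qed.

Lemma not_lt0 x : ~ x < 0.
Proof. by move=> /lt_not_le; apply; apply: le0. Qed.

Lemma le_add x x' y y' : x <= x' -> y <= y' -> x + y <= x' + y'.
Proof.
have le_addl u v z : u <= v -> u + z <= v + z.
  by move=> [uv|->]; [left; apply: (PA_lt_add hP)|right].
move=> xx yy; apply: le_trans (le_addl _ _ _ xx) _.
by rewrite !(PA_addC hP x'); apply: le_addl.
Qed.

Lemma le_addr x y : x <= x + y.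
Proof. by rewrite -{1}[x](PA_add0 hP); apply: le_add (le_refl x) (le0 y). Qed.

Lemma le_addl x y : y <= x + y.
Proof. by rewrite (PA_addC hP); apply: le_addr. Qed.

Lemma le_mul x x' y y' : x <= x' -> y <= y' -> x * y <= x' * y'.
Proof.
have le_mull u v z : u <= v -> u * z <= v * z.
  case: (le0 z) => [z0|<-]; last by rewrite !(PA_mul0 hP); right.
  by move=> [uv|->]; [left; apply: (PA_lt_mul hP)|right].
move=> xx yy; apply: le_trans (le_mull _ _ _ xx) _.
by rewrite !(PA_mulC hP x'); apply: le_mull.
Qed.

Lemma lt_add1 x : x < x + 1.
Proof.
have -> : x + 1 = 1 + x by ring.
have {1}-> : x = 0 + x by ring.
exact: PA_lt_add hP _ _ _ (PA_lt01 hP).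
Qed.

Lemma lt_succ x y : x < y + 1 <-> x <= y.
Proof.
split=> [xy|/le_lt_trans]; last by apply; apply: lt_add1.
case: (le_or_lt x y) => // /[dup] yx /(PA_lt_sub hP)[z yz].
case: (lt_not_le xy); rewrite -yz; apply: le_add (le_refl y) _.
apply: (PA_discrete hP); case: (le0 z) => // z0.
by move: yx; rewrite -yz -z0 (PA_add0 hP) => /lt_irrefl.
Qed.

Lemma succ_le x y : x < y -> x + 1 <= y.
Proof. by move=> xy; case: (le_or_lt (x + 1) y) => // /lt_succ/(lt_not_le xy). Qed.

Lemma add_cancel x y z : x + z = y + z -> x = y.
Proof.
move=> e; case: (PA_lt_total hP x y) => [|[//|]] /(PA_lt_add hP z);
  by rewrite e => /lt_irrefl.
Qed.

Lemma le_sqr x : x <= x * x.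
Proof.
case: (le0 x) => [/(PA_discrete hP) x1|<-]; last by rewrite (PA_mul0 hP); right.
by rewrite -{1}[x](PA_mul1 hP); apply: le_mul (le_refl x) x1.
Qed.

Lemma le_pairl x y : x <= mpair x y. Proof. exact: le_addl. Qed.

Lemma le_pairr x y : y <= mpair x y.
Proof.
by apply: le_trans (le_addl x y) _; apply: le_trans (le_sqr _) (le_addr _ _).
Qed.

Lemma mpair_inj x y u v : mpair x y = mpair u v -> x = u /\ y = v.
Proof.
have pair_lt x' y' x0 y0 : x' + y' < x0 + y0 -> mpair x' y' < mpair x0 y0.
  move=> /succ_le lz; rewrite /mpair; set z := x' + y' in lz *.
  apply: (@lt_le_trans _ ((z + 1) * (z + 1))).
    apply: (@le_lt_trans _ (z * z + z)).
      by apply: le_add (le_refl _) _; apply: le_addr.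
    apply: (@lt_le_trans _ (z * z + z + 1)); first exact: lt_add1.
    have -> : (z + 1) * (z + 1) = z * z + z + 1 + z by ring.
    exact: le_addr.
  exact: le_trans (le_mul lz lz) (le_addr _ _).
move=> e.
have s : x + y = u + v.
  by case: (PA_lt_total hP (x + y) (u + v)) => [|[//|]] /pair_lt;
    rewrite e => /lt_irrefl.
have xu : x = u.
  move: e; rewrite /mpair s !(PA_addC hP ((u + v) * _)); exact: add_cancel.
by split=> //; move: s; rewrite xu !(PA_addC hP u); apply: add_cancel.
Qed.

Lemma le_double x : x <= (1 + 1) * x.
Proof. have -> : (1 + 1) * x = x + x by ring. exact: le_addr. Qed.

Lemma double_lt x y : x < y -> (1 + 1) * x + 1 < (1 + 1) * y.
Proof.
move=> /succ_le xy; apply: (@lt_le_trans _ ((1 + 1) * (x + 1))).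
  have -> : (1 + 1) * (x + 1) = (1 + 1) * x + 1 + 1 by ring.
  exact: lt_add1.
exact: le_mul (le_refl _) xy.
Qed.

Lemma double_inj x y : (1 + 1) * x = (1 + 1) * y -> x = y.
Proof.
move=> e; case: (PA_lt_total hP x y) => [|[//|]] /double_lt;
  by rewrite e => /lt_not_le; case; apply: le_addr.
Qed.

Lemma double_neq_odd x y : (1 + 1) * x <> (1 + 1) * y + 1.
Proof.
move=> e; case: (le_or_lt x y) => [xy|/double_lt]; last by rewrite e => /lt_irrefl.
have : (1 + 1) * x < (1 + 1) * x + 1 by apply: lt_add1.
by rewrite {1}e => /lt_not_le; apply; apply: le_add (le_mul _ _) _; try exact: le_refl.
Qed.

Lemma odd_inj x y : (1 + 1) * x + 1 = (1 + 1) * y + 1 -> x = y.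
Proof. by move/add_cancel/double_inj. Qed.

Lemma le_common_bound x y : exists z, x <= z /\ y <= z.
Proof.
case: (le_or_lt x y) => h; first by exists y; split=> //; right.
by exists x; split; [right|left].
Qed.

End Arithmetic.

Section Definability.
Context (M : structure).
Implicit Types (f g : seq M -> M) (P Q : seq (set M) -> seq M -> Prop).
Implicit Types (R : seq (set M) -> M -> seq M -> Prop).

Definition term_fun f := exists t, forall rho, eval rho t = f rho.

(* One formula serves all values of the set and number parameters, as a Turing
   functional requires. *)
Definition delta0 P := exists phi, forall Xi rho, sat Xi rho phi <-> P Xi rho.

Lemma term_var i : term_fun (fun rho => nth zero rho i).
Proof. by exists (TVar i). Qed.

Lemma term_zero : term_fun (fun _ => 0). Proof. by exists TZero. Qed.

Lemma term_one : term_fun (fun _ => 1). Proof. by exists TOne. Qed.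

Lemma term_add f g :
  term_fun f -> term_fun g -> term_fun (fun rho => f rho + g rho).
Proof. by move=> [t tE] [u uE]; exists (TAdd t u) => rho /=; rewrite tE uE. Qed.

Lemma term_mul f g :
  term_fun f -> term_fun g -> term_fun (fun rho => f rho * g rho).
Proof. by move=> [t tE] [u uE]; exists (TMul t u) => rho /=; rewrite tE uE. Qed.

Lemma term_mpair f g :
  term_fun f -> term_fun g -> term_fun (fun rho => mpair (f rho) (g rho)).
Proof.
by move=> fT gT; apply: term_add => //; apply: term_mul; apply: term_add.
Qed.

Lemma term_behead f : term_fun f -> term_fun (fun rho => f (behead rho)).
Proof.
move=> [t tE].
suff [u uE] : term_fun (fun rho => eval (behead rho) t).
  by exists u => rho; rewrite uE tE.
elim: {tE} t => [i|||t tT u uT|t tT u uT] /=.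
- by exists (TVar i.+1) => rho /=; rewrite nth_behead.
- exact: term_zero.
- exact: term_one.
- exact: term_add.
- exact: term_mul.
Qed.

Definition iter_behead (b : seq M -> seq M) :=
  exists k, forall rho, b rho = drop k rho.

Lemma delta0_iff P Q :
  (forall Xi rho, P Xi rho <-> Q Xi rho) -> delta0 P -> delta0 Q.
Proof. by move=> PQ [p pE]; exists p => Xi rho; rewrite pE. Qed.

Lemma delta0_eq f g :
  term_fun f -> term_fun g -> delta0 (fun _ rho => f rho = g rho).
Proof. by move=> [t tE] [u uE]; exists (FEq t u) => Xi rho /=; rewrite tE uE. Qed.

Lemma delta0_lt f g :
  term_fun f -> term_fun g -> delta0 (fun _ rho => f rho < g rho).
Proof. by move=> [t tE] [u uE]; exists (FLt t u) => Xi rho /=; rewrite tE uE. Qed.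

Lemma delta0_mem i f :
  term_fun f -> delta0 (fun Xi rho => nth set0 Xi i (f rho)).
Proof. by move=> [t tE]; exists (FMem t i) => Xi rho /=; rewrite tE. Qed.

Lemma delta0_not P : delta0 P -> delta0 (fun Xi rho => ~ P Xi rho).
Proof. by move=> [p pE]; exists (FNot p) => Xi rho /=; rewrite pE. Qed.

Lemma delta0_and P Q :
  delta0 P -> delta0 Q -> delta0 (fun Xi rho => P Xi rho /\ Q Xi rho).
Proof. by move=> [p pE] [q qE]; exists (FAnd p q) => Xi rho /=; rewrite pE qE. Qed.

Lemma delta0_or P Q :
  delta0 P -> delta0 Q -> delta0 (fun Xi rho => P Xi rho \/ Q Xi rho).
Proof. by move=> [p pE] [q qE]; exists (FOr p q) => Xi rho /=; rewrite pE qE. Qed.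

Lemma delta0_imp P Q :
  delta0 P -> delta0 Q -> delta0 (fun Xi rho => P Xi rho -> Q Xi rho).
Proof.
move=> pD qD; apply: delta0_iff (delta0_or (delta0_not pD) qD) => Xi rho.
by split=> [[|]//|PQ]; case: (pselect (P Xi rho)) => [/PQ|]; [right|left].
Qed.

Lemma delta0_le f g :
  term_fun f -> term_fun g -> delta0 (fun _ rho => f rho <= g rho).
Proof. by move=> fT gT; apply: delta0_or; [apply: delta0_lt|apply: delta0_eq]. Qed.

Lemma delta0_ex_lt f R : term_fun f ->
  delta0 (fun Xi rho => R Xi (nth zero rho 0) (behead rho)) ->
  delta0 (fun Xi rho => exists x, x < f rho /\ R Xi x rho).
Proof.
move=> [t tE] [p pE]; exists (FEx t p) => Xi rho /=; rewrite tE.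
by split=> -[x [xf xR]]; exists x; split=> //; apply/(pE Xi (x :: rho)).
Qed.

Lemma delta0_all_lt f R : term_fun f ->
  delta0 (fun Xi rho => R Xi (nth zero rho 0) (behead rho)) ->
  delta0 (fun Xi rho => forall x, x < f rho -> R Xi x rho).
Proof.
move=> [t tE] [p pE]; exists (FAll t p) => Xi rho /=; rewrite tE.
by split=> H x xf; apply/(pE Xi (x :: rho)); apply: H.
Qed.

Context (hP : PA_minus M).

Lemma delta0_ex_bounded f R : (forall Xi x rho, R Xi x rho -> x <= f rho) ->
  term_fun f -> delta0 (fun Xi rho => R Xi (nth zero rho 0) (behead rho)) ->
  delta0 (fun Xi rho => exists x, R Xi x rho).
Proof.
move=> Rf fT RD.
apply: delta0_iff (delta0_ex_lt (term_add fT term_one) RD) => Xi rho.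
split=> -[x]; first by move=> [_ ?]; exists x.
by move=> Rx; exists x; split=> //; apply/lt_succ => //; apply: Rf Rx.
Qed.

Lemma delta0_all_le f R : term_fun f ->
  delta0 (fun Xi rho => R Xi (nth zero rho 0) (behead rho)) ->
  delta0 (fun Xi rho => forall x, x <= f rho -> R Xi x rho).
Proof.
move=> fT RD.
apply: delta0_iff (delta0_all_lt (term_add fT term_one) RD) => Xi rho.
by split=> R_ x xf; apply: R_; apply/(lt_succ hP).
Qed.

Lemma delta0_ex_le f R : term_fun f ->
  delta0 (fun Xi rho => R Xi (nth zero rho 0) (behead rho)) ->
  delta0 (fun Xi rho => exists x, x <= f rho /\ R Xi x rho).
Proof.
move=> fT RD; apply: delta0_ex_bounded (fT) _; first by move=> Xi x rho [].
apply: delta0_and RD; apply: delta0_le; first exact: term_var.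
exact: term_behead.
Qed.

Lemma iter_behead0 : iter_behead id.
Proof. by exists 0%N => rho; rewrite drop0. Qed.

Lemma iter_beheadS b : iter_behead b -> iter_behead (fun rho => behead (b rho)).
Proof. by move=> [k kE]; exists k.+1 => rho; rewrite kE -drop1 drop_drop. Qed.

Lemma term_iter_behead b f :
  iter_behead b -> term_fun f -> term_fun (fun rho => f (b rho)).
Proof.
move=> [k]; elim: k f b => [|k IH] f b bE fT.
  by have [t tE] := fT; exists t => rho; rewrite bE drop0 tE.
have [t tE] := IH _ (drop k) (fun=> erefl) (term_behead fT).
by exists t => rho; rewrite tE bE -drop1 drop_drop.
Qed.

End Definability.

Ltac definable_term :=
  cbv beta;
  lazymatch goal with
  | |- term_fun (fun rho => zero) => exact: term_zero
  | |- term_fun (fun rho => one) => exact: term_one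
  | |- term_fun (fun rho => add _ _) => apply: term_add; definable_term
  | |- term_fun (fun rho => mul _ _) => apply: term_mul; definable_term
  | |- term_fun (fun rho => mpair _ _) => apply: term_mpair; definable_term
  | |- term_fun (fun rho => nth zero rho _) => exact: term_var
  | |- @term_fun ?M (fun rho => nth zero (@?b rho) ?i) =>
      refine (@term_iter_behead M b (fun rho => nth zero rho i) _ _);
      [repeat first [exact: iter_behead0 | apply: iter_beheadS] | exact: term_var]
  | |- @term_fun ?M (fun rho => ?f (@?b rho)) =>
      refine (@term_iter_behead M b f _ _);
      [repeat first [exact: iter_behead0 | apply: iter_beheadS] | assumption]
  | |- term_fun _ => assumption
  end.

Ltac definable_with atom hP :=
  cbv beta;
  lazymatch goal with
  | |- delta0 (fun _ rho => _ = _) => apply: delta0_eq; definable_term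
  | |- delta0 (fun _ rho => lt _ _) => apply: delta0_lt; definable_term
  | |- delta0 (fun _ rho => le _ _) => apply: delta0_le; definable_term
  | |- delta0 (fun Xi rho => nth set0 Xi _ _) => apply: delta0_mem; definable_term
  | |- delta0 (fun _ rho => _ /\ _) => apply: delta0_and; definable_with atom hP
  | |- delta0 (fun _ rho => _ \/ _) => apply: delta0_or; definable_with atom hP
  | |- delta0 (fun _ rho => ~ _) => apply: delta0_not; definable_with atom hP
  | |- delta0 (fun _ rho => exists x, lt x _ /\ _) =>
      apply: delta0_ex_lt; [definable_term | definable_with atom hP]
  | |- delta0 (fun _ rho => exists x, le x _ /\ _) =>
      apply: (delta0_ex_le hP); [definable_term | definable_with atom hP]
  | |- delta0 (fun _ rho => forall x, lt x _ -> _) =>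
      apply: delta0_all_lt; [definable_term | definable_with atom hP]
  | |- delta0 (fun _ rho => forall x, le x _ -> _) =>
      apply: (delta0_all_le hP); [definable_term | definable_with atom hP]
  | |- delta0 (fun _ rho => _ -> _) => apply: delta0_imp; definable_with atom hP
  | |- _ => atom
  end.

Section Stages.
Context (M : structure) (hP : PA_minus M).
Implicit Types (f g c i r s t e x y h : seq M -> M).

Lemma entry_bound (a b z : M) : entry a b z -> z <= a.
Proof.
move=> [u [v [-> [_ [q ->]]]]]; apply: (le_trans hP) (le_pairl hP _ _).
exact: le_addl.
Qed.

Lemma delta0_entry c i r : term_fun c -> term_fun i -> term_fun r ->
  delta0 (fun _ rho => entry (c rho) (i rho) (r rho)).
Proof.
move=> cT iT rT.
apply: (delta0_ex_bounded hP (f := c)); [|definable_term|].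
  by move=> _ a rho [b [-> _]]; apply: le_pairl.
apply: (delta0_ex_bounded hP (f := fun rho => c (behead rho))); [|definable_term|].
  by move=> _ b rho [-> _]; apply: le_pairr.
definable_with idtac hP.
apply: (delta0_ex_bounded hP (f := fun rho => nth zero rho 1)); [|definable_term|].
  move=> _ q rho; rewrite nth_behead => ->.
  apply: (le_trans hP) (le_addr hP _ _).
  rewrite -{1}[q](PA_mul1 hP); apply: (le_mul hP); first exact: le_refl.
  exact: le_addr.
definable_with idtac hP.
Qed.

Ltac definable :=
  definable_with ltac:(idtac; lazymatch goal with
    | |- delta0 (fun _ rho => entry _ _ _) => apply: delta0_entry; definable_term
    | |- _ => idtac end) hP.

Lemma instr_bound (w q r u v : M) : instr w q r u v -> r <= w.
Proof.
have le_pair2 (x y z : M) : y <= mpair x (mpair y z).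
  exact: (le_trans hP) (le_pairl hP _ _) (le_pairr hP _ _).
by case=> [[-> _]|[k [l [-> _]]]].
Qed.

Lemma delta0_instr w q r u v :
  term_fun w -> term_fun q -> term_fun r -> term_fun u -> term_fun v ->
  delta0 (fun (_ : seq (set M)) rho =>
    instr (w rho) (q rho) (r rho) (u rho) (v rho)).
Proof.
move=> wT qT rT uT vT; rewrite /instr; definable.
apply: (delta0_ex_bounded hP (f := w)); [|definable_term|].
  move=> _ k rho [l [-> _]].
  do 2 apply: (le_trans hP) (le_pairr hP _ _); exact: le_pairl.
apply: (delta0_ex_bounded hP (f := fun rho => w (behead rho))); [|definable_term|].
  by move=> _ l rho [-> _]; do 2 apply: (le_trans hP) (le_pairr hP _ _);
     apply: le_pairr.
definable.
Qed.

Lemma delta0_initial e x h : term_fun e -> term_fun x -> term_fun h ->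
  delta0 (fun (_ : seq (set M)) rho => initial (e rho) (x rho) (h rho)).
Proof.
move=> eT xT hT.
apply: (delta0_iff (P := fun _ rho => entry (h rho) (mpair 0 0) 0 /\
  entry (h rho) (mpair 0 1) (x rho) /\
  forall k, k <= e rho -> 0 < k -> entry (h rho) (mpair 0 (k + 1)) 0)).
  by move=> _ rho; split=> -[? [? H]]; split=> //; split=> // i *; apply: H.
definable.
Qed.

Lemma delta0_step e L p h t :
  term_fun e -> term_fun L -> term_fun p -> term_fun h -> term_fun t ->
  delta0 (fun (_ : seq (set M)) rho =>
    step (e rho) (L rho) (p rho) (h rho) (t rho)).
Proof.
move=> eT LT pT hT tT; rewrite /step.
apply: (delta0_ex_bounded hP (f := L)); [|definable_term|].
  by move=> _ j rho [w [q [r [u [v [? _]]]]]]; left.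
apply: (delta0_ex_bounded hP (f := fun rho => p (behead rho)));
  [|definable_term|].
  by move=> _ w rho [q [r [u [v [_ [/entry_bound]]]]]].
apply: (delta0_ex_bounded hP (f := fun rho => h (behead (behead rho))));
  [|definable_term|].
  by move=> _ q rho [r [u [v [_ [_ [_ [_ [/entry_bound]]]]]]]].
apply: (delta0_ex_bounded hP (f := fun rho => nth zero rho 1));
  [|definable_term|].
  by move=> _ r rho [u [v [_ [_ [/instr_bound]]]]]; rewrite !nth_behead.
apply: (delta0_ex_bounded hP
  (f := fun rho => h (behead (behead (behead (behead rho))))));
  [|definable_term|].
  by move=> _ u rho [v [_ [_ [_ [_ [_ [/entry_bound]]]]]]].
apply: (delta0_ex_bounded hP
  (f := fun rho => h (behead (behead (behead (behead (behead rho)))))));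
  [|definable_term|].
  by move=> _ v rho [_ [_ [_ [_ [_ [_ [/entry_bound]]]]]]].
definable; first by apply: delta0_instr; definable_term.
apply: (delta0_ex_bounded hP (f := fun rho => h (iter 7 behead rho)));
  [|definable_term|].
  by move=> _ z rho [/entry_bound].
definable.
Qed.

Lemma delta0_accepts e x h t :
  term_fun e -> term_fun x -> term_fun h -> term_fun t ->
  delta0 (fun (_ : seq (set M)) rho =>
    accepts (e rho) (x rho) (h rho) (t rho)).
Proof.
move=> eT xT hT tT.
apply: (delta0_ex_bounded hP (f := e)); [|definable_term|].
  by move=> _ L rho [p [-> _]]; apply: le_pairl.
apply: (delta0_ex_bounded hP (f := fun rho => e (behead rho)));
  [|definable_term|].
  by move=> _ p rho [-> _]; apply: le_pairr.
definable.
- by apply: delta0_initial; definable_term.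
- by apply: delta0_step; definable_term.
apply: (delta0_ex_bounded hP (f := fun rho => h (behead (behead rho))));
  [|definable_term|].
  by move=> _ j rho [/entry_bound].
definable.
Qed.

Lemma delta0_W_stage e s x :
  term_fun e -> term_fun s -> term_fun x ->
  delta0 (fun (_ : seq (set M)) rho => W_stage (e rho) (s rho) (x rho)).
Proof.
move=> eT sT xT.
apply: (delta0_iff (P := fun _ rho => exists k, k <= s rho /\
    exists T, T <= s rho /\ accepts (e rho) (x rho) k T)).
  move=> _ rho; split=> [[h [hs [T [Ts ?]]]]|[h [T [hs [Ts ?]]]]].
    by exists h, T.
  by exists h; split=> //; exists T.
by definable; apply: delta0_accepts; definable_term.
Qed.

Lemma W_stage_bound (e s x : M) : W_stage e s x -> x <= s.
Proof.
move=> [h [T [hs [_ [L [p [_ [[_ [/entry_bound xh _]] _]]]]]]]].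
exact: (le_trans hP) xh hs.
Qed.

Lemma W_stage_mono (e s t x : M) : s <= t -> W_stage e s x -> W_stage e t x.
Proof.
move=> st [h [T [hs [Ts a]]]]; exists h, T.
by split; [|split=> //]; apply: (le_trans hP) st.
Qed.

End Stages.

Section Substitution.
Context (M : structure).
Implicit Types (F : seq M -> seq M) (P : seq (set M) -> seq M -> Prop).

Definition env_fun F := forall i, term_fun (fun rho => nth zero (F rho) i).

Lemma env_iter_behead b : iter_behead b -> env_fun b.
Proof.
by move=> bE i; apply: (term_iter_behead (f := fun rho => nth zero rho i)) bE _;
  apply: term_var.
Qed.

Lemma env_behead F : env_fun F -> env_fun (fun rho => F (behead rho)).
Proof. by move=> FE i; apply: (term_behead (FE i)). Qed.

Lemma env_id : env_fun id. Proof. by move=> i; apply: term_var. Qed.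

Lemma env_cons f F :
  term_fun f -> env_fun F -> env_fun (fun rho => f rho :: F rho).
Proof. by move=> fT FE [|i]; [apply: fT|apply: FE]. Qed.

Lemma delta0_subst F P :
  env_fun F -> delta0 P -> delta0 (fun Xi rho => P Xi (F rho)).
Proof.
move=> FE [p pE]; apply: (delta0_iff (P := fun Xi rho => sat Xi (F rho) p)).
  by move=> Xi rho.
have evalF t G : env_fun G -> term_fun (fun rho => eval (G rho) t).
  move=> GE; elim: t => [i|||t tT u uT|t tT u uT] /=.
  - exact: GE.
  - exact: term_zero.
  - exact: term_one.
  - exact: term_add.
  - exact: term_mul.
elim: {P pE} p F FE => [t u|t u|t i|p IH|p IHp q IHq|p IHp q IHq|t p IH|t p IH]
    F FE /=.
- by apply: delta0_eq; apply: evalF.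
- by apply: delta0_lt; apply: evalF.
- by apply: delta0_mem; apply: evalF.
- by apply: delta0_not; apply: IH.
- by apply: delta0_and; [apply: IHp|apply: IHq].
- by apply: delta0_or; [apply: IHp|apply: IHq].
- apply: delta0_all_lt; first exact: evalF.
  by apply: (IH (fun rho => _ :: _)); apply: env_cons (term_var _ _) (env_behead FE).
- apply: delta0_ex_lt; first exact: evalF.
  by apply: (IH (fun rho => _ :: _)); apply: env_cons (term_var _ _) (env_behead FE).
Qed.

End Substitution.

Section Join.
Context (M : structure) (hP : PA_minus M).

Definition join (X : set M) (C : M -> M -> M -> Prop) : set M :=
  [set z | (exists x, z = (1 + 1) * x /\ X x) \/
    exists x y c, z = (1 + 1) * mpair (mpair x y) c + 1 /\ C x y c].

Lemma left_half_join X C : left_half (join X C) = X.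
Proof.
apply/predeqP => x; split=> [[[y [/(double_inj hP) -> //]]|]|Xx].
  by move=> [u [v [c [/(double_neq_odd hP)]]]].
by left; exists x.
Qed.

Lemma SRT2_color_join X C x y c : SRT2_color (join X C) x y c <-> C x y c.
Proof.
split=> [[|]|Cxyc]; last by right; exists x, y, c.
  by move=> [z [/esym/(double_neq_odd hP)]].
move=> [u [v [d [/(odd_inj hP)/(mpair_inj hP)[/(mpair_inj hP)[-> ->] ->]]]]].
by [].
Qed.

Lemma delta0_join PX PC (F : seq M -> seq M) z :
  delta0 PX -> delta0 PC -> env_fun F -> term_fun z ->
  delta0 (fun Xi rho => join (fun x => PX Xi (x :: F rho))
    (fun x y c => PC Xi [:: c, y, x & F rho]) (z rho)).
Proof.
move=> XD CD FE zT; apply: delta0_or.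
  apply: (delta0_ex_bounded hP (f := z)); [|definable_term|].
    by move=> _ x rho [-> _]; apply: (le_double hP).
  apply: delta0_and; first by apply: delta0_eq; definable_term.
  apply: (delta0_subst (F := fun rho => _ :: _)) XD.
  by apply: env_cons (env_behead FE); definable_term.
have boundl (x y c : M) : mpair x y <= (1 + 1) * mpair (mpair x y) c + 1.
  apply: (le_trans hP) (le_addr hP _ _); apply: (le_trans hP) (le_double hP _).
  exact: le_pairl.
have boundr (x y c : M) : c <= (1 + 1) * mpair (mpair x y) c + 1.
  apply: (le_trans hP) (le_addr hP _ _); apply: (le_trans hP) (le_double hP _).
  exact: le_pairr.
apply: (delta0_ex_bounded hP (f := z)); [|definable_term|].
  move=> _ x rho [y [c [-> _]]]; apply: (le_trans hP) (boundl x y c).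
  exact: le_pairl.
apply: (delta0_ex_bounded hP (f := fun rho => z (behead rho)));
  [|definable_term|].
  move=> _ y rho [c [-> _]]; apply: (le_trans hP) (boundl _ y c).
  exact: le_pairr.
apply: (delta0_ex_bounded hP (f := fun rho => z (behead (behead rho))));
  [|definable_term|].
  by move=> _ c rho [-> _].
apply: delta0_and; first by apply: delta0_eq; definable_term.
apply: (delta0_subst (F := fun rho => [:: _, _, _ & _])) CD.
apply: env_cons; first by definable_term.
apply: env_cons; first by definable_term.
apply: env_cons; first by definable_term.
exact: env_behead (env_behead (env_behead FE)).
Qed.

End Join.

Lemma infinite_gt (M : structure) (A : set M) k :
  PA_minus M -> infinite A -> exists x, A x /\ k < x.
Proof.
move=> hP Ainf; apply: contrapT => H; apply: Ainf; exists k => x Ax.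
by apply: (not_lt_le hP) => kx; apply: H; exists x.
Qed.

Section Induction.
Context (M : structure) (hF : RCA0star M).
Let hP : PA_minus M := PA_minus_of hF.
Context (P : seq (set M) -> seq M -> Prop) (PD : delta0 P).
Context (Xi : seq (set M)) (hXi : List.Forall (sets M) Xi).

Lemma delta0_comprehension rho : sets M [set x | P Xi (x :: rho)].
Proof.
have [p pE] : delta0 (fun Xi rho => P Xi (behead rho)).
  by apply: delta0_subst PD; exact: env_behead (env_id M).
have -> : [set x | P Xi (x :: rho)] = [set x | sigma01 Xi (x :: rho) p].
  apply/predeqP => x; split=> [Px|[y /pE]//].
  by exists 0; apply/pE.
apply: (delta01_comprehension hF (psi := p)) hXi _ => x.
by split=> [[y /pE ?] z|/(_ 0)/pE ?]; [|exists 0]; apply/pE.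
Qed.

Lemma delta0_boundary rho b : P Xi (0 :: rho) -> ~ P Xi (b :: rho) ->
  exists c, P Xi (c :: rho) /\ ~ P Xi (c + 1 :: rho).
Proof.
move=> P0; apply: contra_notP => /forallNP H; have [p pE] := PD.
apply/pE; move: b; apply: (delta00_induction hF) hXi _ _; first exact/pE.
by move=> x /pE Px; apply/pE; apply: contrapT => nPx1; apply: (H x).
Qed.

End Induction.

Section Cut.
Context (M : structure) (hF : RCA0star M) (hS : realizes M SRT2).
Let hP : PA_minus M := PA_minus_of hF.

(* If the Sigma^0_1 set J of all [c] with [P c s] for some [s] were a proper cut,
   then the set X of stages [s] at which a new element enters J would be
   infinite, and coloring a pair [s < t] in X by the greatest [c] that is in J
   at stage [s] would be stable, with at most [b] colors, and with no homogeneous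
   set of three elements. *)
Lemma sigma1_boundary P Xi (rho : seq M) b :
  delta0 P -> List.Forall (sets M) Xi ->
  (forall y z s, z <= y -> P Xi (y :: s :: rho) -> P Xi (z :: s :: rho)) ->
  (forall y s t, s <= t -> P Xi (y :: s :: rho) -> P Xi (y :: t :: rho)) ->
  (exists s, P Xi (0 :: s :: rho)) -> ~ (exists s, P Xi (b :: s :: rho)) ->
  exists c, (exists s, P Xi (c :: s :: rho)) /\
    ~ exists s, P Xi (c + 1 :: s :: rho).
Proof.
move=> PD hXi Pdown Pup P0 Pb; apply: contrapT => H.
have PS c : (exists s, P Xi (c :: s :: rho)) ->
    exists s, P Xi (c + 1 :: s :: rho).
  by move=> Pc; apply: contrapT => Pc1; apply: H; exists c.
have Pltb c s : P Xi (c :: s :: rho) -> c < b.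
  move=> Pc; case: (le_or_lt hP b c) => // bc.
  by case: Pb; exists s; apply: Pdown bc Pc.
have boundary (s c : M) : P Xi (c :: s :: rho) ->
    exists d, P Xi (d :: s :: rho) /\ ~ P Xi (d + 1 :: s :: rho).
  move=> Pc; apply: (delta0_boundary hF PD hXi (b := b)).
    by apply: Pdown Pc; apply: (le0 hP).
  by move=> Pbs; apply: Pb; exists s.
pose X : set M := fun s => exists y, y < b /\ P Xi (y :: s :: rho) /\
  forall t, t < s -> ~ P Xi (y :: t :: rho).
pose C s (t : M) c := P Xi (c :: s :: rho) /\ ~ P Xi (c + 1 :: s :: rho).
have first_stage y : (exists s, P Xi (y :: s :: rho)) ->
    exists s, X s /\ P Xi (y :: s :: rho).
  move=> [s Ps]; have yb := Pltb _ _ Ps.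
  case: (pselect (P Xi [:: y, 0 & rho])) => [Py0|nPy0].
    exists 0; split=> //; exists y; split=> //; split=> // t.
    by move/(not_lt0 hP).
  have nPD : delta0 (fun Xi rho => ~ P Xi (nth zero rho 1 :: nth zero rho 0 ::
      behead (behead rho))).
    apply/delta0_not/(delta0_subst (F := fun rho => [:: _, _ & _])) => //.
    do 2 (apply: env_cons; first definable_term).
    exact: env_behead (env_behead (env_id M)).
  have [|c [nPc Pc1]] :=
      delta0_boundary hF nPD hXi (rho := y :: rho) (b := s) nPy0.
    by apply.
  exists (c + 1); move: Pc1 => /= /contrapT Pc1.
  split=> //; exists y; split=> //; split=> // t /(lt_succ hP) tc Pt.
  by apply: nPc => /=; apply: Pup tc Pt.
have Xinf : infinite X.
  move=> [t Xt].
  have Pt y : (exists s, P Xi (y :: s :: rho)) -> P Xi (y :: t :: rho).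
    by move=> /first_stage[s [/Xt st]]; apply: Pup st.
  have [c [Pc Pc1]] := boundary t 0 (Pt _ P0).
  by apply: Pc1; apply: Pt; apply: PS; exists t.
have Xcolor s t : X s -> exists c, C s t c.
  by move=> [y [_ [Py _]]]; have [d] := boundary s y Py; exists d.
have C_uniq s t c d : C s t c -> C s t d -> c = d.
  move=> [Pc nPc] [Pd nPd]; case: (PA_lt_total hP c d) => [|[//|]].
    by move=> /(succ_le hP) cd; case: nPc; apply: Pdown cd Pd.
  by move=> /(succ_le hP) dc; case: nPd; apply: Pdown dc Pc.
have hI : sets M (join X C).
  pose PX Xi rho := exists y, y < nth zero rho 1 /\
    (P Xi [:: y, nth zero rho 0 & behead (behead rho)] /\
    forall t, t < nth zero rho 0 -> ~ P Xi [:: y, t & behead (behead rho)]).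
  pose PC Xi rho := P Xi [:: nth zero rho 0, nth zero rho 2 & drop 4 rho] /\
    ~ P Xi [:: nth zero rho 0 + 1, nth zero rho 2 & drop 4 rho].
  have drop_env k : @env_fun M (fun rho => drop k rho).
    by apply: env_iter_behead; exists k.
  have PXD : delta0 PX.
    rewrite /PX; definable_with idtac hP.
      apply: (delta0_subst (F := fun rho => [:: _, _ & _])) PD.
      do 2 (apply: env_cons; first definable_term).
      exact: (env_behead (env_behead (env_behead (env_id M)))).
    apply: (delta0_subst (F := fun rho => [:: _, _ & _])) PD.
    do 2 (apply: env_cons; first definable_term).
    exact: (env_behead (env_behead (env_behead (env_behead (env_id M))))).
  have PCD : delta0 PC.
    by apply: delta0_and; [|apply: delta0_not];
      apply: (delta0_subst (F := fun rho => [:: _, _ & _])) PD;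
      do 2 (apply: env_cons; first definable_term); apply: drop_env.
  have D : delta0 (fun Xi rho => join (fun x => PX Xi (x :: behead rho))
      (fun x y c => PC Xi [:: c, y, x & behead rho]) (nth zero rho 0)).
    apply: (delta0_join hP PXD PCD (F := behead)); last exact: term_var.
    exact: env_behead (env_id M).
  have := delta0_comprehension hF D hXi (b :: rho).
  by rewrite /PX /PC /= drop0.
have inst : SRT2_instance (join X C).
  have lX := left_half_join hP X C.
  split; first by rewrite lX.
  split; [exists b => s t|move=> s]; rewrite lX => Xs.
    move=> _ _; split=> [|c /(SRT2_color_join hP)[/Pltb]//].
    have [c Cc] := Xcolor s t Xs; exists c; split.
      exact/(SRT2_color_join hP).
    by move=> d /(SRT2_color_join hP); apply: C_uniq Cc.
  have [c Cc] := Xcolor s s Xs; exists c, s => t _ _ _.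
  exact/(SRT2_color_join hP).
have [S [_ [Sinf [SX [c Sc]]]]] := hS hI inst.
have [s [Ss _]] := infinite_gt 0 hP Sinf.
have [t [St st]] := infinite_gt s hP Sinf.
have [u [Su tu]] := infinite_gt t hP Sinf.
have /(SRT2_color_join hP)[Pcs _] := Sc s t Ss St st.
have /(SRT2_color_join hP)[_ nPct] := Sc t u St Su tu.
have := SX t St; rewrite left_half_join // => -[y [_ [Pyt nPy]]].
apply: (nPy s st); case: (le_or_lt hP y c) => [yc|/(succ_le hP) cy].
  exact: Pdown yc Pcs.
by case: nPct; apply: Pdown cy Pyt.
Qed.

End Cut.

Section Coloring.
Context (M : structure).
Implicit Types (I : set M) (n x s e y z : M).

(* Bounding [f(e)] by [s] keeps this Delta^0_0. *)
Definition ficf_stage I e s y :=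
  exists z, z <= s /\ (FICF_fun I e z /\ W_stage z s y).

Definition all_before I n x s y :=
  forall v, v < y -> x <= v -> forall e, e < n -> ficf_stage I e s v.

Definition in_first I s y e := forall d, d < e -> ficf_stage I d s y.

Definition ficf_color I n x s e :=
  e < n /\ exists y, y <= s + 1 /\ (x <= y /\ (all_before I n x s y /\
    (in_first I s y e /\ ~ ficf_stage I e s y))).

Context (hF : RCA0star M).
Let hP : PA_minus M := PA_minus_of hF.

Lemma delta0_ficf_stage i (e s y : seq M -> M) :
  term_fun e -> term_fun s -> term_fun y ->
  delta0 (fun Xi rho => ficf_stage (nth set0 Xi i) (e rho) (s rho) (y rho)).
Proof.
move=> eT sT yT.
rewrite /ficf_stage; definable_with idtac hP.
  by apply: delta0_mem; definable_term.
by apply: (delta0_W_stage hP); definable_term.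
Qed.

Ltac definable := definable_with ltac:(idtac; lazymatch goal with
  | |- delta0 (fun _ rho => ficf_stage _ _ _ _) =>
      apply: delta0_ficf_stage; definable_term
  | |- _ => idtac end) hP.

Lemma delta0_all_before i (n x s y : seq M -> M) :
  term_fun n -> term_fun x -> term_fun s -> term_fun y ->
  delta0 (fun Xi rho =>
    all_before (nth set0 Xi i) (n rho) (x rho) (s rho) (y rho)).
Proof. by move=> nT xT sT yT; rewrite /all_before; definable. Qed.

Lemma delta0_in_first i (s y e : seq M -> M) :
  term_fun s -> term_fun y -> term_fun e ->
  delta0 (fun Xi rho => in_first (nth set0 Xi i) (s rho) (y rho) (e rho)).
Proof. by move=> sT yT eT; rewrite /in_first; definable. Qed.

Lemma delta0_ficf_color i (n x s e : seq M -> M) :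
  term_fun n -> term_fun x -> term_fun s -> term_fun e ->
  delta0 (fun Xi rho =>
    ficf_color (nth set0 Xi i) (n rho) (x rho) (s rho) (e rho)).
Proof.
move=> nT xT sT eT; rewrite /ficf_color; definable.
- by apply: delta0_all_before; definable_term.
- by apply: delta0_in_first; definable_term.
Qed.

Lemma ficf_stage_mono I e s t y :
  s <= t -> ficf_stage I e s y -> ficf_stage I e t y.
Proof.
move=> st [z [zs [fz Wz]]]; exists z; split; first exact: (le_trans hP) zs st.
by split=> //; apply: (W_stage_mono hP) st Wz.
Qed.

Lemma ficf_stage_bound I e s y : ficf_stage I e s y -> y <= s.
Proof. by move=> [z [_ [_ /(W_stage_bound hP)]]]. Qed.

Lemma all_before_extend I n x s y : all_before I n x s y ->
  in_first I s y n -> all_before I n x s (y + 1).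
Proof.
move=> ab yin v /(lt_succ hP)[vy|->]; first exact: ab.
by move=> _; apply: yin.
Qed.

Lemma in_first_extend I s y e : in_first I s y e ->
  ficf_stage I e s y -> in_first I s y (e + 1).
Proof. by move=> ye yin d /(lt_succ hP)[de|->] //; apply: ye. Qed.

Lemma all_before_mono I n x s t y : s <= t ->
  all_before I n x s y -> all_before I n x t y.
Proof. by move=> st ab v vy xv e en; apply: ficf_stage_mono st (ab v vy xv e en). Qed.

Lemma in_first_mono I s t y e : s <= t -> in_first I s y e -> in_first I t y e.
Proof. by move=> st ye d de; apply: ficf_stage_mono st (ye d de). Qed.

Lemma in_first_le I s y d e : d <= e -> in_first I s y e -> in_first I s y d.
Proof. by move=> de ye c cd; apply: ye; apply: (lt_le_trans hP) cd de. Qed.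

Lemma all_before_le I n x s y z : z <= y ->
  all_before I n x s y -> all_before I n x s z.
Proof. by move=> zy ab v vz; apply: ab; apply: (lt_le_trans hP) vz zy. Qed.

Lemma all_before_low I n x s y : y <= x -> all_before I n x s y.
Proof.
by move=> yx v vy /(lt_not_le hP (lt_le_trans hP vy yx)).
Qed.

Lemma ficf_color_uniq I n x s d e :
  ficf_color I n x s d -> ficf_color I n x s e -> d = e.
Proof.
move=> [dn [y [_ [xy [aby [yd ny]]]]]] [en [z [_ [xz [abz [ze nz]]]]]].
case: (PA_lt_total hP y z) => [yz|[yz|zy]].
- by case: ny; apply: abz.
- case: (PA_lt_total hP d e) => [de|[//|ed]].
    by case: ny; rewrite yz; apply: ze.
  by case: nz; rewrite -yz; apply: yd.
- by case: nz; apply: aby.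
Qed.

Lemma ficf_color_total I n x s : sets M I -> 0 < n -> x < s ->
  exists e, ficf_color I n x s e.
Proof.
move=> hI n0 xs; have hXi : List.Forall (sets M) [:: I] by repeat constructor.
have ns : ~ all_before I n x s (s + 1 + 1).
  move=> /(_ (s + 1) (lt_add1 hP _)) H.
  have /ficf_stage_bound : ficf_stage I 0 s (s + 1).
    apply: H n0; left; apply: (lt_trans hP) xs _; exact: lt_add1.
  by move/(lt_not_le hP (lt_add1 hP s)).
have abD : delta0 (fun Xi rho => all_before (nth set0 Xi 0) (nth zero rho 1)
    (nth zero rho 2) (nth zero rho 3) (nth (zero : M) rho 0)).
  by apply: delta0_all_before; definable_term.
have [||y [aby naby]] :=
    delta0_boundary hF abD hXi (rho := [:: n; x; s]) (b := s + 1 + 1) => //.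
  by apply: all_before_low; apply: (le0 hP).
move: aby naby => /= aby naby.
have inD : delta0 (fun Xi rho => in_first (nth set0 Xi 0) (nth zero rho 1)
    (nth zero rho 2) (nth (zero : M) rho 0)).
  by apply: delta0_in_first; definable_term.
have nyn : ~ in_first I s y n by move/(all_before_extend aby).
have [||e [ye nye]] :=
    delta0_boundary hF inD hXi (rho := [:: s; y]) (b := n) => //.
  by move=> d /(not_lt0 hP).
move: ye nye => /= ye nye; exists e; split.
  case: (le_or_lt hP n e) => // ne; case: nyn; exact: in_first_le ne ye.
exists y; split.
  case: (le_or_lt hP y (s + 1)) => // /(succ_le hP) sy.
  by case: ns; apply: all_before_le sy aby.
split.
  case: (le_or_lt hP x y) => // /(succ_le hP) yx; case: naby.
  exact: all_before_low.
by split=> //; split=> // /(in_first_extend ye).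
Qed.

Lemma ficf_color_limit I n x b : realizes M SRT2 -> sets M I ->
  x <= b -> (exists e, e < n /\ forall s, ~ ficf_stage I e s b) ->
  exists e y t, x <= y /\ (forall s, ~ ficf_stage I e s y) /\
    forall s, t < s -> ficf_color I n x s e.
Proof.
move=> hS hI xb [eb [ebn nb]].
have hXi : List.Forall (sets M) [:: I] by repeat constructor.
have abD : delta0 (fun Xi rho => all_before (nth set0 Xi 0) (nth zero rho 2)
    (nth zero rho 3) (nth zero rho 1) (nth (zero : M) rho 0)).
  by apply: delta0_all_before; definable_term.
have [|||| y [[s0 aby] naby]] :=
    sigma1_boundary hF hS (rho := [:: n; x]) (b := b + 1) abD hXi => /=.
- by move=> y z s; apply: all_before_le.
- by move=> y s t; apply: all_before_mono.
- by exists 0; apply: all_before_low; apply: (le0 hP).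
- by move=> [s /(_ b (lt_add1 hP b) xb eb ebn)/nb].
have inD : delta0 (fun Xi rho => in_first (nth set0 Xi 0) (nth zero rho 1)
    (nth zero rho 2) (nth (zero : M) rho 0)).
  by apply: delta0_in_first; definable_term.
have nyn : ~ exists s, in_first I s y n.
  move=> [s yn]; have [t [st s0t]] := le_common_bound hP s s0.
  case: naby; exists t; apply: all_before_extend; first exact: all_before_mono aby.
  exact: in_first_mono yn.
have [|||| e [[s1 ye] nye]] :=
    sigma1_boundary hF hS (rho := [:: y]) (b := n) inD hXi => //=.
- by move=> d c s; apply: in_first_le.
- by move=> d s t; apply: in_first_mono.
- by exists 0 => d /(not_lt0 hP).
have [t0 [s0t0 s1t0]] := le_common_bound hP s0 s1.
have [t [yt t0t]] := le_common_bound hP y t0.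
have ny s : ~ ficf_stage I e s y.
  move=> ys; case: nye; have [u [su s1u]] := le_common_bound hP s s1.
  exists u; apply: in_first_extend; first exact: in_first_mono ye.
  exact: ficf_stage_mono ys.
have xy : x <= y.
  case: (le_or_lt hP x y) => // /(succ_le hP) yx; case: naby.
  by exists 0; apply: all_before_low.
exists e, y, t; split=> //; split=> // s ts.
have {}t0s : t0 <= s by apply: (le_trans hP) t0t _; left.
split.
  case: (le_or_lt hP n e) => // ne; case: nyn.
  by exists s1; apply: in_first_le ne ye.
exists y; split.
  apply: (le_trans hP) yt _; left; apply: (lt_trans hP) ts _; exact: lt_add1.
split=> //; split; first by apply: all_before_mono aby; apply: (le_trans hP) t0s.
by split=> //; apply: in_first_mono ye; apply: (le_trans hP) t0s.
Qed.

End Coloring.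

Section Reduction.
Context (M : structure) (hF : RCA0star M).
Let hP : PA_minus M := PA_minus_of hF.

Definition color_join (I : set M) n :=
  join (fun _ : M => True) (ficf_color I n).

Definition common_color (I S : set M) (w z : M) :=
  exists n, n <= w /\ (left_half I n /\ exists x, x <= w /\ (S x /\
    exists y, y <= w /\ (S y /\ (x < y /\ ficf_color I n x y z)))).

Lemma delta0_color_join : delta0 (fun Xi (rho : seq M) =>
  color_join (nth set0 Xi 0) (nth zero rho 0) (nth zero rho 1)).
Proof.
apply: (delta0_join hP (F := id) (PX := fun _ _ => True)
  (PC := fun Xi rho => ficf_color (nth set0 Xi 0) (nth zero rho 3)
    (nth zero rho 2) (nth zero rho 1) (nth zero rho 0))).
- apply: (delta0_iff (P := fun _ _ => zero = zero)) => //.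
  by apply: delta0_eq; definable_term.
- by apply: (delta0_ficf_color hF); definable_term.
- exact: env_id.
- exact: term_var.
Qed.

Lemma delta0_common_color (w z : seq M -> M) : term_fun w -> term_fun z ->
  delta0 (fun Xi rho =>
    common_color (nth set0 Xi 0) (nth set0 Xi 1) (w rho) (z rho)).
Proof.
move=> wT zT; rewrite /common_color; definable_with idtac hP.
  by apply: delta0_mem; definable_term.
by apply: (delta0_ficf_color hF); definable_term.
Qed.

Lemma ficf_functional : exists Phi : functional M, forall I n,
  left_half I = [set n] ->
  total_on Phi [:: I] /\ value Phi [:: I] = color_join I n.
Proof.
have leftD : delta0 (fun Xi (rho : seq M) =>
    left_half (nth set0 Xi 0) (nth zero rho 0)).
  by apply: delta0_mem; definable_term.
have [p pE] := delta0_and leftD delta0_color_join.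
have [q qE] := delta0_and leftD (delta0_not delta0_color_join).
exists (Functional p q [::]) => I n In.
have posE z : sigma01 [:: I] [:: z] p <-> color_join I n z.
  split=> [[m /pE[/=]]|Iz]; first by rewrite In => ->.
  by exists n; apply/pE; rewrite /= In.
have negE z : sigma01 [:: I] [:: z] q <-> ~ color_join I n z.
  split=> [[m /qE[/=]]|Iz]; first by rewrite In => ->.
  by exists n; apply/qE; rewrite /= In.
split=> [z|]; first by rewrite /= posE negE notK.
by apply/predeqP => z; apply: posE.
Qed.

Lemma common_color_functional : exists Psi : functional M, forall I S n x y c,
  left_half I = [set n] -> S x -> S y -> x < y ->
  (forall u v, S u -> S v -> u < v -> ficf_color I n u v c) ->
  total_on Psi [:: I; S] /\ value Psi [:: I; S] = [set c].
Proof.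
have ccD : delta0 (fun Xi (rho : seq M) => common_color (nth set0 Xi 0)
    (nth set0 Xi 1) (nth zero rho 0) (nth zero rho 1)).
  by apply: delta0_common_color; definable_term.
have [p pE] := ccD.
have [q qE] : delta0 (fun Xi (rho : seq M) => exists d, d <= nth zero rho 0 /\
    (common_color (nth set0 Xi 0) (nth set0 Xi 1) (nth zero rho 0) d /\
    ~ d = nth zero rho 1)).
  definable_with idtac hP.
  by apply: delta0_common_color; definable_term.
exists (Functional p q [::]) => I S n x y c In Sx Sy xy homog.
have ccE w d : common_color I S w d -> d = c.
  move=> [m [_ [+ [u [_ [Su [v [_ [Sv [uv +]]]]]]]]]]; rewrite In => ->.
  by move/ficf_color_uniq; apply => //; apply: homog.
have [w [cw ccw]] : exists w, c <= w /\ common_color I S w c.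
  have [w1 [nw1 xw1]] := le_common_bound hP n x.
  have [w2 [yw2 cw2]] := le_common_bound hP y c.
  have [w [w1w w2w]] := le_common_bound hP w1 w2.
  exists w; split; first exact: (le_trans hP) w2w.
  exists n; split; first exact: (le_trans hP) w1w.
  rewrite In; split=> //; exists x; split; first exact: (le_trans hP) w1w.
  split=> //; exists y; split; first exact: (le_trans hP) w2w.
  by split=> //; split=> //; apply: homog.
have posE z : sigma01 [:: I; S] [:: z] p <-> z = c.
  split=> [[v /pE/ccE //]|->]; first by exists w; apply/pE.
have negE z : sigma01 [:: I; S] [:: z] q <-> z <> c.
  split=> [[v /qE[d [_ [/ccE -> /nesym]]]] //|zc].
  by exists w; apply/qE; exists c; split=> //; split=> // /esym.
split=> [z|]; first by rewrite /= posE negE notK.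
by apply/predeqP => z; apply: posE.
Qed.

Lemma FICF_instance_missing (I : set M) : FICF_instance I ->
  exists n, left_half I = [set n] /\ 0 < n /\
    forall x, exists b, x <= b /\
      exists e, e < n /\ forall s, ~ ficf_stage I e s b.
Proof.
move=> [n [In [fun_I [_ ncof]]]]; exists n.
have missing x : exists b, x <= b /\
    exists e, e < n /\ forall s, ~ ficf_stage I e s b.
  apply: contrapT => H; apply: ncof; exists x => b xb e y en fy.
  apply: contrapT => nWb; apply: H; exists b; split; first by left.
  exists e; split=> // s [z [_ [fz Wz]]]; apply: nWb; exists s.
  by have [v [_ vE]] := fun_I e; rewrite -(vE y fy) (vE z fz).
split=> //; split=> //; have [b [_ [e [en _]]]] := missing 0.
exact: (le_lt_trans hP) (le0 hP e) en.
Qed.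

Lemma color_join_SRT2 (I : set M) n : realizes M SRT2 -> sets M I -> 0 < n ->
  (forall x, exists b, x <= b /\
    exists e, e < n /\ forall s, ~ ficf_stage I e s b) ->
  SRT2_instance (color_join I n).
Proof.
move=> hS hI n0 missing; rewrite /SRT2_instance /coloring /stable.
rewrite (left_half_join hP); split.
  by move=> [t /(_ _ Logic.I)] tmax; apply: (lt_not_le hP (lt_add1 hP t)).
split.
  exists n => x y _ _ xy; split=> [|c /(SRT2_color_join hP)[]//].
  have [c xyc] := ficf_color_total hF hI n0 xy.
  exists c; split=> [|d /(SRT2_color_join hP)]; first exact/(SRT2_color_join hP).
  exact: ficf_color_uniq xyc.
move=> x _; have [b [xb nb]] := missing x.
have [e [y [t [_ [_ te]]]]] := ficf_color_limit hF hS hI xb nb.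
by exists e, t => s _ _ ts; apply/(SRT2_color_join hP); apply: te.
Qed.

End Reduction.

Theorem theorem7 (M : structure) (hF : RCA0star M) (hS : realizes M SRT2) :
  weihrauch M FICF SRT2.
Proof.
have hP := PA_minus_of hF.
split=> //; have [Phi PhiE] := ficf_functional hF.
have [Psi PsiE] := common_color_functional hF.
exists Phi, Psi => I hI instI.
have [n [In [n0 missing]]] := FICF_instance_missing hF instI.
have [Phi_total PhiI] := PhiE I n In; rewrite /= PhiI.
split=> //; split; first exact: color_join_SRT2.
move=> S hSS [Sinf [_ [c homogS]]].
have {}homogS u v : S u -> S v -> u < v -> ficf_color I n u v c.
  by move=> Su Sv /(homogS _ _ Su Sv)/(SRT2_color_join hP).
have [x [Sx _]] := infinite_gt 0 hP Sinf.
have [y [Sy xy]] := infinite_gt x hP Sinf.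
have [Psi_total ->] := PsiE I S n x y c In Sx Sy xy homogS.
split=> //; have [_ [_ [fun_I _]]] := instI.
have [z [fz _]] := fun_I c.
exists n, c, z; split=> //; split; first by case: (homogS x y).
split=> //; split=> // -[k Wk].
have [u [Su ku]] := infinite_gt k hP Sinf.
have [b [ub nb]] := missing u.
have [e [v [t [uv [nv te]]]]] := ficf_color_limit hF hS hI ub nb.
have [t' [tt' ut']] := le_common_bound hP t u.
have [w [Sw tw]] := infinite_gt t' hP Sinf.
have ec : e = c.
  apply: (ficf_color_uniq hF (te w (le_lt_trans hP tt' tw))).
  exact: homogS (le_lt_trans hP ut' tw).
have [s Ws] := Wk v (lt_le_trans hP ku uv).
have [s' [ss' zs']] := le_common_bound hP s z.
apply: (nv s'); rewrite ec; exists z; split=> //; split=> //.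
exact: (W_stage_mono hP) ss' Ws.
Qed.
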